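(* Let $R$ be a ring whose additive group $(R,+)$ is finitely generated. Then a subset $S$ of $R$ generates $R$ as a ring if and only if the reduction of $S$ modulo every prime $p$ generates the ring $R/pR$. If $(R,+)$ is infinite, then in general no prime number may be omitted in the previous sentence.
   Context: All rings are associative with a two-sided identity element. The reduction of $S$ modulo a prime $p$ is the image of $S$ under the quotient map $R \to R/pR$. A set $S$ generates a ring $A$ if every element of $A$ is a $\mathbb{Z}$-linear combination of nonempty products of elements of $S$ (the identity element is not automatically included). *)

(* Defs.v *)
From HB Require Import structures.
From mathcomp Require Import all_boot all_order all_algebra.
From mathcomp Require Import boolp classical_sets cardinality.

Set Implicit Arguments.
Unset Strict Implicit.
Unset Printing Implicit Defensive.

Import GRing.Theory.
Local Open Scope ring_scope.
Local Open Scope classical_set_scope.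

Definition fg_zmodule (V : zmodType) : Prop :=
  exists (m : nat) (s : m.-tuple V), forall v : V, inIntSpan s v.

Definition nonempty_products (A : pzRingType) (S : set A) : set A :=
  [set x | exists w : seq A,
     [/\ w != [::], (forall y, y \in w -> S y) & x = \prod_(y <- w) y]].

(* No unit is added: the empty product is excluded, so 1 has to be obtained
   from the elements of S. *)
Definition generates_ring (A : pzRingType) (S : set A) : Prop :=
  forall a : A, exists (m : nat) (s : m.-tuple A),
    (forall x, x \in s -> nonempty_products S x) /\ inIntSpan s a.

(* The two-sided ideal nR. *)
Definition multiples (R : pzRingType) (n : nat) : {pred R} :=
  fun x => `[< exists y : R, x = y *+ n >].
Arguments multiples : clear implicits.

Section Multiples.
Variables (R : pzRingType) (n : nat).

Lemma multiplesP (x : R) :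
  reflect (exists y : R, x = y *+ n) (x \in multiples R n).
Proof. exact: asboolP. Qed.

Lemma multiples_zmod_closed : zmod_closed (multiples R n).
Proof.
split=> [|_ _ /multiplesP[x ->] /multiplesP[y ->]]; apply/multiplesP.
  by exists 0; rewrite mul0rn.
by exists (x - y); rewrite mulrnBl.
Qed.

HB.instance Definition _ :=
  GRing.isZmodClosed.Build R (multiples R n) multiples_zmod_closed.

Lemma multiplesMl (a x : R) : x \in multiples R n -> a * x \in multiples R n.
Proof.
by move=> /multiplesP[y ->]; apply/multiplesP; exists (a * y); rewrite mulrnAr.
Qed.

Lemma multiplesMr (a x : R) : x \in multiples R n -> x * a \in multiples R n.
Proof.
by move=> /multiplesP[y ->]; apply/multiplesP; exists (y * a); rewrite mulrnAl.
Qed.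

End Multiples.

(* MathComp's {quot I} is the quotient additive group R/I, with a ring structure
   only for R commutative and I proper.  Here R need not be commutative, and nR
   may be all of R, so that R/nR may be the zero ring. *)
Definition ring_mod (R : pzRingType) (n : nat) : Type :=
  Quotient.quot (multiples R n : zmodClosed R).

Section RingMod.
Variables (R : pzRingType) (n : nat).
Local Notation Q := (ring_mod R n).

HB.instance Definition _ :=
  GRing.Zmodule.copy Q (Quotient.quot (multiples R n : zmodClosed R)).

Definition reduction (x : R) : Q :=
  \pi_(Quotient.quot (multiples R n : zmodClosed R))%qT x.

Local Notation rpr := (fun u : Q =>
  repr (u : Quotient.quot (multiples R n : zmodClosed R))).

Lemma reduction_reprK (u : Q) : reduction (rpr u) = u.
Proof. exact: reprK. Qed.

Lemma reductionP (x y : R) :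
  reflect (reduction x = reduction y) (x - y \in multiples R n).
Proof. by rewrite Quotient.idealrBE; apply: eqP. Qed.

Lemma reductionD (x y : R) : reduction (x + y) = reduction x + reduction y.
Proof. exact: pi_addr. Qed.

Definition ring_mod_one : Q := reduction 1.
Definition ring_mod_mul (u v : Q) : Q := reduction (rpr u * rpr v).

Lemma ring_mod_mulE (x y : R) :
  ring_mod_mul (reduction x) (reduction y) = reduction (x * y).
Proof.
apply/reductionP; set x' := rpr _; set y' := rpr _.
have hx : x' - x \in multiples R n by apply/reductionP; exact: reduction_reprK.
have hy : y' - y \in multiples R n by apply/reductionP; exact: reduction_reprK.
rewrite -(subrKA (x' * y)) -mulrBr -mulrBl.
by apply: rpredD; [exact: multiplesMl | exact: multiplesMr].
Qed.

Lemma ring_mod_mulA : associative ring_mod_mul.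
Proof.
move=> u v w; rewrite -(reduction_reprK u) -(reduction_reprK v).
by rewrite -(reduction_reprK w) !ring_mod_mulE mulrA.
Qed.

Lemma ring_mod_mul1l : left_id ring_mod_one ring_mod_mul.
Proof. by move=> u; rewrite -(reduction_reprK u) ring_mod_mulE mul1r. Qed.

Lemma ring_mod_mul1r : right_id ring_mod_one ring_mod_mul.
Proof. by move=> u; rewrite -(reduction_reprK u) ring_mod_mulE mulr1. Qed.

Lemma ring_mod_mulDl : left_distributive ring_mod_mul +%R.
Proof.
move=> u v w; rewrite -(reduction_reprK u) -(reduction_reprK v).
rewrite -(reduction_reprK w) -reductionD !ring_mod_mulE.
by rewrite -reductionD mulrDl.
Qed.

Lemma ring_mod_mulDr : right_distributive ring_mod_mul +%R.
Proof.
move=> u v w; rewrite -(reduction_reprK u) -(reduction_reprK v).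
rewrite -(reduction_reprK w) -reductionD !ring_mod_mulE.
by rewrite -reductionD mulrDr.
Qed.

HB.instance Definition _ := GRing.Zmodule_isPzRing.Build Q
  ring_mod_mulA ring_mod_mul1l ring_mod_mul1r ring_mod_mulDl ring_mod_mulDr.

Lemma reduction_zmod_morphism : zmod_morphism reduction.
Proof. exact: raddfB. Qed.

Lemma reduction_monoid_morphism : monoid_morphism reduction.
Proof. by split=> // x y; rewrite -ring_mod_mulE. Qed.

HB.instance Definition _ :=
  GRing.isZmodMorphism.Build R Q reduction reduction_zmod_morphism.
HB.instance Definition _ :=
  GRing.isMonoidMorphism.Build R Q reduction reduction_monoid_morphism.

Lemma reduction_surj (u : Q) : exists x : R, reduction x = u.
Proof. by exists (rpr u); exact: reduction_reprK. Qed.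

Lemma reduction_eq0 (x : R) :
  reduction x = 0 <-> exists y : R, x = y *+ n.
Proof.
rewrite -(raddf0 reduction); split.
  by move=> /reductionP; rewrite subr0 => /multiplesP.
by move=> h; apply/reductionP; rewrite subr0; apply/multiplesP.
Qed.

End RingMod.

Arguments reduction {R} n x.

(* Main.v *)
Require Import Defs.
From mathcomp Require Import all_boot all_order all_algebra.
From mathcomp Require Import boolp classical_sets cardinality.
From mathcomp Require Import ring.

(** A subset [S] of a ring generates it exactly when the additive subgroup
[A = zspan (nonempty_products S)] is everything.  Homomorphisms carry products
to products and integer combinations to integer combinations, so the reduction
of [S] modulo [p] generates [R/pR] if and only if [A + pR = R]
([generates_ring_reduction]).  The claim is thereby about abelian groups: the
finitely generated group [M = R/A] satisfies [M = pM] for every prime [p], and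
must be shown to vanish.

The tool is a form of Nakayama's lemma ([subgroup_nakayama]): if [M] is finitely
generated and [M = pM], then some [1 + kp] annihilates [M].  As [1 + kp] is
nonzero, already a single prime gives a positive [n] with [nM = 0]; writing [n]
as a product of primes, [M = pM] for its prime factors gives [M = nM = 0].

No prime [p] can be omitted when [R] is infinite: take [S = pR].  For a prime
[q] other than [p], the integer [p] is invertible modulo [q], so [pR] maps onto
[R/qR].  The subring generated by [pR] lies in [pR], and [pR = R] would by the
same tool give [nR = 0] for some positive [n], making the finitely generated
group [(R,+)] finite ([finite_of_torsion]). *)

Set Implicit Arguments.
Unset Strict Implicit.
Unset Printing Implicit Defensive.

Import GRing.Theory Num.Theory.
Local Open Scope classical_set_scope.

(** * Subgroups of finitely generated abelian groups *)

Section Subgroups.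
Local Open Scope ring_scope.
Variable V : zmodType.
Implicit Types P X : set V.

Definition subgroup P := P 0 /\ forall x y, P x -> P y -> P (x - y).

Definition zspan X : set V :=
  [set a | exists (m : nat) (s : m.-tuple V),
     (forall x, x \in s -> X x) /\ inIntSpan s a].

Lemma subgroupN P x : subgroup P -> P x -> P (- x).
Proof. by move=> [P0 PB] Px; rewrite -sub0r; apply: PB. Qed.

Lemma subgroupD P x y : subgroup P -> P x -> P y -> P (x + y).
Proof.
by move=> sP Px Py; rewrite -[y]opprK; apply: sP.2 => //; apply: subgroupN.
Qed.

Lemma subgroupMn P x n : subgroup P -> P x -> P (x *+ n).
Proof.
move=> sP Px; elim: n => [|n IHn]; first by rewrite mulr0n; apply: sP.1.
by rewrite mulrS; apply: subgroupD.
Qed.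

Lemma subgroupMz P x (k : int) : subgroup P -> P x -> P (x *~ k).
Proof.
move=> sP Px; case: k => n; first exact: subgroupMn.
by rewrite NegzE mulrNz; apply: subgroupN => //; apply: subgroupMn.
Qed.

Lemma subgroup_inIntSpan P m (s : m.-tuple V) a :
  subgroup P -> (forall x, x \in s -> P x) -> inIntSpan s a -> P a.
Proof.
move=> sP sub_sP [c ->]; apply: big_ind => [|x y|i _].
- exact: sP.1.
- exact: subgroupD.
- by apply: subgroupMz => //; apply: sub_sP; rewrite mem_nth ?size_tuple.
Qed.

Lemma zspan_min P X : subgroup P -> X `<=` P -> zspan X `<=` P.
Proof.
move=> sP XP a [m [s [sX]]]; apply: subgroup_inIntSpan => // x /sX; exact: XP.
Qed.

Lemma sub_zspan X : X `<=` zspan X.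
Proof.
move=> x Xx; exists 1%N, [tuple x]; split=> [y|]; first by rewrite inE => /eqP->.
by exists [ffun=> 1]; rewrite big_ord1 ffunE mulr1z.
Qed.

Lemma zspan_subgroup X : subgroup (zspan X).
Proof.
split=> [|x y [m [s [sX [a ->]]]] [n [t [tX [b ->]]]]].
  by exists 0%N, [tuple]; split=> //; exists [ffun=> 0]; rewrite big_ord0.
exists (m + n)%N, [tuple of s ++ t]; split=> [z|].
  by rewrite mem_cat => /orP[/sX|/tX].
exists [ffun i => match split i with inl j => a j | inr j => - b j end].
rewrite big_split_ord -sumrN; congr (_ + _); apply: eq_bigr => i _; rewrite ffunE.
  by rewrite (unsplitK (inl i)) nth_cat size_tuple /= ltn_ord.
rewrite (unsplitK (inr i)) nth_cat size_tuple /= ltnNge leq_addr /=.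
by rewrite addKn mulrNz.
Qed.

(** Quotients are avoided by arguing modulo a subgroup [P]; the last hypothesis
says that [s] generates the quotient [M] of [V] by [P], in the form that survives
enlarging [P].  The subgroup is enlarged by one element [x] of [s] at a time.  If
[1 + kp] annihilates [M] modulo [x] and [x = py], then
[(1 + kp)x = p((1 + kp)y) = p(jx)] for some [j], so [1 + (k - j)p] kills [x]. *)
Lemma subgroup_nakayama (p : nat) (s : seq V) P :
  subgroup P -> (forall v, exists y, P (v - y *+ p)) ->
  (forall Q, subgroup Q -> P `<=` Q -> (forall x, x \in s -> Q x) ->
     forall v, Q v) ->
  exists k : int, forall v, P (v *~ (1 + k * p%:Z)).
Proof.
elim: s P => [|x s IHs] P sP divP genP.
  by exists 0 => v; apply: genP.
pose P' := [set v | exists j : int, P (v - x *~ j)].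
have sPP' : P `<=` P' by move=> v Pv; exists 0; rewrite mulr0z subr0.
have sP' : subgroup P'.
  split=> [|u v [i Pu] [j Pv]]; first exact: sPP' sP.1.
  exists (i - j); rewrite mulrzBr.
  have -> : u - v - (x *~ i - x *~ j) = (u - x *~ i) - (v - x *~ j).
    by rewrite !opprD addrACA.
  exact: sP.2.
have P'x : P' x by exists 1; rewrite mulr1z subrr; exact: sP.1.
have [|Q sQ sP'Q sQs|k Pk] := IHs P' sP'.
- by move=> v; have [y Py] := divP v; exists y; apply: sPP'.
- apply: genP => //; first exact: subset_trans sP'Q.
  by move=> z; rewrite inE => /predU1P[->|/sQs //]; apply: sP'Q.
have [y Py] := divP x; have [j Pj] := Pk y.
have Px : P (x *~ (1 + (k - j) * p%:Z)).
  have := subgroupD sP (subgroupMz (1 + k * p%:Z) sP Py) (subgroupMz p%:Z sP Pj).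
  rewrite !mulrzBl -[y *+ p]/(y *~ p%:Z) [y *~ _ *~ _]mulrzAC addrA subrK.
  by rewrite -mulrzA -mulrzBr -addrA -mulrBl.
(* The product (1 + k p) (1 + (k - j) p) is again 1 modulo p. *)
exists ((1 + k * p%:Z) * (k - j) + k) => v; have [i Pi] := Pk v.
have -> : 1 + ((1 + k * p%:Z) * (k - j) + k) * p%:Z =
          (1 + k * p%:Z) * (1 + (k - j) * p%:Z).
  by ring.
have := subgroupD sP (subgroupMz (1 + (k - j) * p%:Z) sP Pi) (subgroupMz i sP Px).
by rewrite mulrzBl -!mulrzA [i * _]mulrC subrK.
Qed.

(** The integer [1 + kp] is congruent to 1 modulo [p], hence nonzero. *)
Lemma subgroup_torsion (p : nat) (s : seq V) P :
  prime p -> subgroup P -> (forall v, exists y, P (v - y *+ p)) ->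
  (forall Q, subgroup Q -> P `<=` Q -> (forall x, x \in s -> Q x) ->
     forall v, Q v) ->
  exists2 n : nat, (0 < n)%N & forall v, P (v *+ n).
Proof.
move=> p_pr sP divP genP; have [k Pk] := subgroup_nakayama sP divP genP.
exists `|(1 + k * p%:Z)%R|%N => [|v].
  rewrite absz_gt0; apply/eqP => /(congr1 (fun z => z %% p%:Z)%Z).
  rewrite addrC modzMDl mod0z modz_small //.
  by rewrite ltz_nat prime_gt1.
have := subgroupMz (sgz (1 + k * p%:Z)) sP (Pk v).
by rewrite -mulrzA mulrC -abszEsg pmulrn.
Qed.

(** Some [n] annihilates the quotient by [P].  Any prime factor [q] of [n] can be
cancelled: [v] is congruent to [qy], so [(n/q)v] is congruent to [ny], which lies
in [P].  Descending, [n] becomes 1. *)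
Lemma subgroup_divisible (s : seq V) P :
  subgroup P -> (forall p v, prime p -> exists y, P (v - y *+ p)) ->
  (forall Q, subgroup Q -> P `<=` Q -> (forall x, x \in s -> Q x) ->
     forall v, Q v) ->
  forall v, P v.
Proof.
move=> sP divP genP.
(* Any prime would do in place of 2. *)
have [n] := subgroup_torsion (isT : prime 2) sP (fun v => divP 2%N v isT) genP.
elim/ltn_ind: n => n IHn n_gt0 Pn.
have [n_gt1|] := ltnP 1 n; last first.
  by case: n n_gt0 Pn {IHn} => [|[|n]] // _ Pn _ v; have := Pn v; rewrite mulr1n.
have p_pr := pdiv_prime n_gt1.
have lt_n : (n %/ pdiv n < n)%N.
  exact: ltn_Pdiv (prime_gt1 p_pr) n_gt0.
have quo_gt0 : (0 < n %/ pdiv n)%N.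
  by rewrite divn_gt0 ?pdiv_gt0 // pdiv_leq.
apply: (IHn _ lt_n quo_gt0) => v; have [y Py] := divP _ v p_pr.
have := subgroupD sP (subgroupMn (n %/ pdiv n)%N sP Py) (Pn y).
by rewrite mulrnBl -mulrnA [(pdiv n * _)%N]mulnC divnK ?pdiv_dvd // subrK.
Qed.

(** Coefficients of integer combinations matter only modulo [n], which leaves
finitely many combinations. *)
Lemma finite_of_torsion (n m : nat) (s : m.-tuple V) :
  (0 < n)%N -> (forall v : V, v *+ n = 0) -> (forall v, inIntSpan s v) ->
  finite_set [set: V].
Proof.
case: n => // n _ Vn genV.
pose f (c : {ffun 'I_m -> 'I_n.+1}) := \sum_(i < m) s`_i *+ c i.
apply: (@sub_finite_set _ _ (f @` [set: {ffun 'I_m -> 'I_n.+1}])); last first.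
  by apply: finite_image; apply: finite_finset.
move=> v _; have [c ->] := genV v.
exists [ffun i => inord `|(c i %% n.+1)%Z|%N] => //.
apply: eq_bigr => i _; rewrite ffunE.
have mod_ge0 : 0 <= (c i %% n.+1)%Z by rewrite modz_ge0.
rewrite inordK; last by rewrite -ltz_nat gez0_abs // ltz_pmod.
rewrite pmulrn gez0_abs // [in RHS](divz_eq (c i) n.+1) [RHS]mulrzDr.
by rewrite mulrzA -pmulrn Vn add0r.
Qed.

End Subgroups.

(** * Generation of rings and reduction modulo a prime *)

Section Generation.
Local Open Scope ring_scope.

Lemma zspan_image (U V : zmodType) (f : {additive U -> V}) (X : set U) :
  zspan (f @` X) = f @` zspan X.
Proof.
apply/seteqP; split.
  apply: zspan_min; last exact: image_subset (@sub_zspan _ X).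
  have [X0 XB] := zspan_subgroup X.
  split=> [|_ _ [x Xx <-] [y Xy <-]]; first by exists 0; rewrite ?raddf0.
  by exists (x - y); rewrite ?raddfB //; apply: XB.
move=> _ [x Xx <-]; apply: (zspan_min _ _ Xx : (f @^-1` zspan (f @` X)) x).
  have [X0 XB] := zspan_subgroup (f @` X).
  by split=> [|u v /= Xu Xv]; rewrite /= ?raddf0 ?raddfB //; apply: XB.
by move=> u Xu; apply: sub_zspan; exists u.
Qed.

Lemma nonempty_products_image (A B : pzRingType) (f : {rmorphism A -> B})
    (S : set A) :
  nonempty_products (f @` S) = f @` nonempty_products S.
Proof.
apply/seteqP; split=> [_ [w [w_n0 wS ->]]|_ [_ [w [w_n0 wS ->]] <-]].
  have [w' [w'S def_w]] : exists w', (forall y, y \in w' -> S y) /\ w = map f w'.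
    elim: w wS {w_n0} => [|z w IHw] wS; first by exists [::].
    have [y wy|w' [w'S ->]] := IHw; first by apply: wS; rewrite inE wy orbT.
    have [x Sx <-] := wS z (mem_head _ _).
    by exists (x :: w'); split=> // y; rewrite inE => /predU1P[->|/w'S].
  exists (\prod_(y <- w') y); last by rewrite rmorph_prod def_w big_map.
  by exists w'; split=> //; case: (w') def_w w_n0 => // ->.
exists (map f w); split; last by rewrite rmorph_prod big_map.
  by case: (w) w_n0.
by move=> _ /mapP[x wx ->]; exists x => //; apply: wS.
Qed.

(** Both products and integer combinations commute with the reduction map, so the
subring generated by the reduction of [S] is the image of the one generated by
[S]; this image is everything when the latter and [pR] together span [R]. *)
Lemma generates_ring_reduction (R : pzRingType) (p : nat) (S : set R) :
  generates_ring (reduction p @` S : set (ring_mod R p)) <->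
  forall a : R, exists y, zspan (nonempty_products S) (a - y *+ p).
Proof.
have -> : generates_ring (reduction p @` S : set (ring_mod R p)) =
    forall u, (reduction p @` zspan (nonempty_products S)) u.
  by rewrite -zspan_image -nonempty_products_image.
split=> [gen a|gen u].
  have [b Ab eq_ab] := gen (reduction p a).
  have /reduction_eq0[y def_y] : reduction p (a - b) = 0.
    by rewrite raddfB /= eq_ab subrr.
  by exists y; rewrite -def_y opprB addrC subrK.
have [a <-] := reduction_surj u; have [y Ay] := gen a.
exists (a - y *+ p) => //; rewrite raddfB /=.
have -> : reduction p (y *+ p) = 0 by apply/reduction_eq0; exists y.
by rewrite subr0.
Qed.

Lemma generates_ring_setT (A : pzRingType) (S : set A) :
  (forall a, S a) -> generates_ring S.
Proof.
move=> ST a; apply: sub_zspan; exists [:: a].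
by split=> //; rewrite big_seq1.
Qed.

(** A Bezout relation [ap = bq + 1] shows that [x] and [(ax)p] agree modulo [q]. *)
Lemma reduction_multiples_surj (R : pzRingType) (p q : nat) (u : ring_mod R q) :
  (0 < p)%N -> coprime p q ->
  (reduction q @` range (fun y : R => y *+ p)) u.
Proof.
move=> p_gt0 co_pq; have [x <-] := reduction_surj u.
have [a b def_ab _] := egcdnP q p_gt0; rewrite (eqP co_pq) in def_ab.
exists (x *+ a *+ p); first by exists (x *+ a).
have qb0 : reduction q (x *+ b *+ q) = 0 by apply/reduction_eq0; exists (x *+ b).
by rewrite -mulrnA def_ab mulrnDr raddfD /= mulrnA qb0 add0r.
Qed.

(** [pR] is an ideal, so the subring that it generates is no larger. *)
Lemma zspan_products_multiples (R : pzRingType) (p : nat) :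
  zspan (nonempty_products (range (fun y : R => y *+ p))) `<=`
  range (fun y : R => y *+ p).
Proof.
apply: zspan_min.
  split=> [|_ _ [x _ <-] [y _ <-]]; first by exists 0; rewrite ?mul0rn.
  by exists (x - y); rewrite ?mulrnBl.
move=> _ [[|z w] [// _ wS ->]]; have [y _ <-] := wS z (mem_head _ _).
by exists (y * \prod_(x <- w) x); rewrite // big_cons mulrnAl.
Qed.

End Generation.

Theorem theorem2p9 (R : pzRingType) (R_fg : fg_zmodule R) :
  (forall S : set R,
     generates_ring S <->
     (forall p : nat, prime p ->
        generates_ring (reduction p @` S : set (ring_mod R p))))
  /\
  (infinite_set [set: R] ->
   forall p : nat, prime p ->
   exists S : set R,
     (forall q : nat, prime q -> q <> p ->
        generates_ring (reduction q @` S : set (ring_mod R q)))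
     /\ ~ generates_ring S).
Proof.
have [m [s genR]] := R_fg.
have genQ (P Q : set R) : subgroup Q -> P `<=` Q ->
    (forall x, x \in tval s -> Q x) -> forall v, Q v.
  by move=> sQ _ sQs v; apply: subgroup_inIntSpan (genR v).
split=> [S|infR p p_pr].
  split=> [genS p _|genS].
    by apply/generates_ring_reduction => a; exists 0%R; rewrite mul0rn subr0.
  apply: subgroup_divisible (zspan_subgroup _) _ (genQ _) => p a p_pr.
  by have /generates_ring_reduction := genS p p_pr; apply.
exists (range (fun y : R => y *+ p)%R); split=> [q q_pr neq_qp|genS].
  apply: generates_ring_setT => u; apply: reduction_multiples_surj.
    exact: prime_gt0.
  by rewrite prime_coprime // dvdn_prime2 //; apply/eqP => /esym.
have s0 : @subgroup R [set 0%R].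
  by split=> // x y /= -> ->; rewrite subr0.
have divR v : exists y : R, [set 0%R] (v - y *+ p)%R.
  have [y _ <-] := zspan_products_multiples (genS v).
  by exists y; rewrite /= subrr.
have [n n_gt0 nR] := subgroup_torsion p_pr s0 divR (genQ _).
exact/infR/(finite_of_torsion n_gt0 nR genR).
Qed.
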